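(* If $N(u)\notin\mathfrak{T}_r^{(d)}$, then there exists a unique solution to the minimization problem $$\min_{v\in\mathcal{T}_u\mathfrak{T}_r^{(d)}}\left\|v-N(u)\right\|^2_{L^2_\mu(\Omega)},$$ i.e., a unique global minimum.
   Context: Let $\Omega=\Omega_1\times\cdots\times\Omega_d$ with $\Omega_i=[a_i,b_i]$ real intervals, and let $\mu=\mu_1\times\cdots\times\mu_d$ be a finite product measure on $\Omega$; all spaces are real. $M_{p\times q}(L^2_\nu(X))$ denotes the $p\times q$ matrices with entries in $L^2_\nu(X)$. For $\Psi,\tilde\Psi\in M_{p\times q}(L^2_\nu(X))$, $C_{\Psi,\tilde\Psi}$ is the real $q\times q$ matrix with entries $[C_{\Psi,\tilde\Psi}]_{ij}=\sum_{k=1}^{p}\langle\Psi_{ki},\tilde\Psi_{kj}\rangle_{L^2_\nu(X)}$. Fix a rank vector $r=(r_0,r_1,\dots,r_d)$ of positive integers with $r_0=r_d=1$. $V^{(i)}_{r_{i-1}\times r_i}$ is the set of $\Psi_i\in M_{r_{i-1}\times r_i}(L^2_{\mu_i}(\Omega_i))$ such that $C_{\Psi_i,\Psi_i}$ is invertible. $\mathfrak{T}_r^{(d)}$ (the functional tensor train tensors of constant rank $r$) is the set of $u\in L^2_\mu(\Omega)$ of the form $u=\Psi_1(x_1)\Psi_2(x_2)\cdots\Psi_d(x_d)$ (matrix product) with $\Psi_i\in V^{(i)}_{r_{i-1}\times r_i}$ for all $i=1,\dots,d$. It is regarded as a smooth Hilbert manifold, whose tangent space at $u\in\mathfrak{T}_r^{(d)}$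 is $$\mathcal{T}_u\mathfrak{T}_r^{(d)}=\left\{\gamma'(s)|_{s=0}:\ \gamma\in\mathcal{C}^1\big((-\delta,\delta),\mathfrak{T}_r^{(d)}\big),\ \gamma(0)=u\right\}\subseteq L^2_\mu(\Omega),$$ where $\mathcal{C}^1\big((-\delta,\delta),\mathfrak{T}_r^{(d)}\big)$ is the space of continuously differentiable functions from $(-\delta,\delta)$ to $\mathfrak{T}_r^{(d)}$. Here $u=u(x,t)\in\mathfrak{T}_r^{(d)}$ at a fixed time $t\in[0,T]$, and $N(u)\in L^2_\mu(\Omega)$ is the right-hand side at $u$ of an autonomous evolution equation $\partial u/\partial t=N(u)$, with $N$ a nonlinear operator which may depend on the spatial variables and may incorporate boundary conditions.
   Formalization: That the tensor train set is a smooth manifold is made an explicit hypothesis: near u it is an embedded smooth submanifold of L^2. It fails where the rank of u is below r, and there uniqueness can fail, e.g. d=2, r=(1,2,1), u=e1f1, N(u)=e1f1+e2f2+e3f3. *)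

(* Defs.v *)
From HB Require Import structures.
From mathcomp Require Import all_boot all_order all_algebra generic_quotient.
From mathcomp Require Import ring_quotient.
From mathcomp Require Import all_classical all_reals all_analysis.
From mathcomp Require Import measurable_realfun.

Set Implicit Arguments.
Unset Strict Implicit.
Unset Printing Implicit Defensive.

Import Order.TTheory GRing.Theory Num.Theory.
Import numFieldNormedType.Exports.

Local Open Scope classical_set_scope.
Local Open Scope ring_scope.
Local Open Scope quotient_scope.

(* The space L^2: square-integrable measurable functions modulo equality
   almost everywhere, as a normedModType.  (The library's LspaceType is the
   same quotient, but it carries no vector space structure.) *)
Section L2_space.
Context (disp : measure_display) (T : measurableType disp) (R : realType).
Variable mu : {measure set T -> \bar R}.

Local Notation L2fun := (LfunType mu (lee1n 2 : (1 <= 2%:R%:E :> \bar R)%E)).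

Definition L2null : {pred L2fun} :=
  fun f => `[< (f : T -> R) = cst 0 %[ae mu] >].

Lemma L2nullP (f : L2fun) :
  reflect ((f : T -> R) = cst 0 %[ae mu]) (f \in L2null).
Proof. exact: asboolP. Qed.

Lemma L2null_zmod : zmod_closed L2null.
Proof.
split; first by apply/L2nullP; exact: aeW.
move=> f g /L2nullP f0 /L2nullP g0; apply/L2nullP.
apply: filterS2 f0 g0 => x /(_ I) f0 /(_ I) g0 _.
by rewrite [LHS](_ : _ = f x - g x)// f0 g0 subrr.
Qed.

HB.instance Definition _ := GRing.isZmodClosed.Build L2fun L2null L2null_zmod.

Definition L2 : Type := {ideal_quot L2null}.

HB.instance Definition _ := GRing.Zmodule.on L2.
HB.instance Definition _ := Quotient.on L2.

Definition L2_to_fun (f : L2) : T -> R := (repr f : L2fun).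
Coercion L2_to_fun : L2 >-> Funclass.

Let cls (f : L2fun) : L2 := \pi_L2 f.

Let clsE (f g : L2fun) : (f - g \in L2null) -> cls f = cls g.
Proof. by rewrite Quotient.idealrBE => /eqP. Qed.

Lemma L2_eqP (f g : L2) : f = g <-> (f : T -> R) = g %[ae mu].
Proof.
split=> [->|fg]; first exact: aeW.
rewrite -[f]reprK -[g]reprK; apply: clsE; apply/L2nullP.
by apply: filterS fg => x /(_ I) fg _; apply/eqP; rewrite subr_eq0; apply/eqP.
Qed.

Lemma L2_piE (f : L2fun) : ((\pi_L2 f : L2) : T -> R) = f %[ae mu].
Proof.
have /L2nullP : repr (cls f) - f \in L2null.
  by rewrite Quotient.idealrBE reprK.
by apply: filterS => x /(_ I) /= /eqP; rewrite subr_eq0 => /eqP.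
Qed.

Lemma L2_addE (f g : L2) : ((f + g : L2) : T -> R) = (f : T -> R) \+ g %[ae mu].
Proof.
have -> : f + g = \pi_L2 (repr f + repr g).
  by rewrite -{1}[f]reprK -{1}[g]reprK !piE.
exact: L2_piE.
Qed.

Definition L2_scale (a : R) (f : L2) : L2 := \pi_L2 (a *: (repr f : L2fun)).

Lemma L2_scaleE a (f : L2) :
  (L2_scale a f : T -> R) = (fun x => a * f x) %[ae mu].
Proof. exact: L2_piE. Qed.

Let scaleA a b (f : L2) :
  L2_scale a (L2_scale b f) = L2_scale (a * b) f.
Proof.
apply/L2_eqP; move: (L2_scaleE a (L2_scale b f)) (L2_scaleE b f)
  (L2_scaleE (a * b) f).
by apply: filterS3 => x /(_ I) e1 /(_ I) e2 /(_ I) e3 _; rewrite e1 e2 e3 mulrA.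
Qed.

Let scale1 : left_id 1 L2_scale.
Proof.
move=> f; apply/L2_eqP; move: (L2_scaleE 1 f).
by apply: filterS => x /(_ I) e1 _; rewrite e1 mul1r.
Qed.

Let scaleDr : right_distributive L2_scale +%R.
Proof.
move=> a f g; apply/L2_eqP.
have h1 := L2_addE f g; have h2 := L2_addE (L2_scale a f) (L2_scale a g).
have h3 := L2_scaleE a f; have h4 := L2_scaleE a g.
have h5 := L2_scaleE a (f + g).
apply: filterS3 (filterI h1 h2) (filterI h3 h4) h5.
move=> x [/(_ I) e1 /(_ I) e2] [/(_ I) e3 /(_ I) e4] /(_ I) e5 _.
by rewrite e5 e1 e2 /= e3 e4 mulrDr.
Qed.

Let scaleDl f : {morph L2_scale^~ f : a b / a + b}.
Proof.
move=> a b; apply/L2_eqP.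
have h1 := L2_addE (L2_scale a f) (L2_scale b f).
have h2 := L2_scaleE (a + b) f.
have h3 := L2_scaleE a f; have h4 := L2_scaleE b f.
apply: filterS3 h1 (filterI h3 h4) h2.
move=> x /(_ I) e1 [/(_ I) e3 /(_ I) e4] /(_ I) e5 _.
by rewrite e5 e1 /= e3 e4 mulrDl.
Qed.

HB.instance Definition _ :=
  GRing.Zmodule_isLmodule.Build R L2 scaleA scale1 scaleDr scaleDl.

Definition L2_norm (f : L2) : R := fine ('N[mu]_2%:R%:E[EFin \o f])%E.

Let L2_norm_ae (f g : T -> R) : measurable_fun setT f -> measurable_fun setT g ->
  f = g %[ae mu] ->
  ('N[mu]_2%:R%:E[EFin \o f] = 'N[mu]_2%:R%:E[EFin \o g])%E.
Proof.
move=> mf mg fg; rewrite unlock; congr (_ `^ _)%E.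
apply: ge0_ae_eq_integral => //.
- apply: (@measurableT_comp _ _ _ _ _ _ (fun x => x `^ 2)%E) => /=.
    exact: measurable_poweR.
  by do 2 apply: measurableT_comp => //.
- apply: (@measurableT_comp _ _ _ _ _ _ (fun x => x `^ 2)%E) => /=.
    exact: measurable_poweR.
  by do 2 apply: measurableT_comp => //.
- by move=> x _; rewrite poweR_ge0.
- by move=> x _; rewrite poweR_ge0.
- by apply: filterS fg => x /(_ I) fg _ /=; rewrite fg.
Qed.

Let mL2 (f : L2) : measurable_fun setT (f : T -> R).
Proof. exact: measurable_funPT. Qed.

Let L2_normE (f : L2) (g : L2fun) : (f : T -> R) = g %[ae mu] ->
  L2_norm f = fine ('N[mu]_2%:R%:E[EFin \o g])%E.
Proof. by move=> fg; congr fine; apply: L2_norm_ae. Qed.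

Let ler_L2_normD f g : L2_norm (f + g) <= L2_norm f + L2_norm g.
Proof.
rewrite (L2_normE (g := repr f + repr g)); last exact: L2_addE.
exact: ler_LnormD.
Qed.

Let L2_normZ a f : L2_norm (a *: f) = `|a| * L2_norm f.
Proof.
rewrite (L2_normE (g := a *: repr f)); last exact: L2_scaleE.
rewrite [X in fine X](LnormZ (repr f) a) fineM//.
by rewrite -finite_norm_fine.
Qed.

Let L2_norm_eq0 f : L2_norm f = 0 -> f = 0.
Proof.
move=> /fine_Lnormr_eq0 f0; have -> : 0 = cls 0 by rewrite /cls !piE.
by rewrite -[f]reprK; apply: clsE; rewrite subr0; apply/L2nullP.
Qed.

HB.instance Definition _ :=
  Lmodule_isNormed.Build R L2 ler_L2_normD L2_normZ L2_norm_eq0.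

Definition L2_dot (f g : L2) : R := \int[mu]_x (f x * g x).

Lemma L2_sqr_norm (f : L2) : `|f| ^+ 2 = L2_dot f f.
Proof.
rewrite -[LHS]/(L2_norm f ^+ 2) /L2_norm /L2_dot /Rintegral.
have := @powR_Lnorm _ _ _ mu (EFin \o f) 2%R.
rewrite pnatr_eq0 => /(_ isT); rewrite -finite_norm_fine poweR_EFin.
rewrite powR_mulrn ?fine_ge0 ?Lnorm_ge0// => /(congr1 fine) /= ->.
congr fine; apply: eq_integral => x _ /=.
by rewrite powR_mulrn// real_normK ?num_real// expr2.
Qed.

End L2_space.

(* For Psi, Psi' in M_{p x q}(L^2), the q x q matrix C_{Psi, Psi'}. *)
Definition cov_mx (disp : measure_display) (T : measurableType disp)
    (R : realType) (mu : {measure set T -> \bar R}) (p q : nat)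
    (Psi Psi' : 'M[L2 mu]_(p, q)) : 'M[R]_q :=
  \matrix_(i, j) \sum_(k < p) L2_dot (Psi k i) (Psi' k j).

Definition tt_core (disp : measure_display) (T : measurableType disp)
    (R : realType) (mu : {measure set T -> \bar R}) (p q : nat) :
    set 'M[L2 mu]_(p, q) :=
  [set Psi | cov_mx Psi Psi \in unitmx].

Fixpoint mxchain (R : realType) (r : nat -> nat) (d : nat) :
    (forall i : 'I_d, 'M[R]_(r i, r i.+1)) -> 'M[R]_(r 0, r d) :=
  match d with
  | 0 => fun=> 1%:M
  | d'.+1 => fun A =>
      mxchain (fun i : 'I_d' => A (widen_ord (leqnSn d') i)) *m A ord_max
  end.

Section functional_tensor_train.
Context (R : realType) (d : nat).
Variable mu_ : 'I_d -> {finite_measure set (measurableTypeR R) -> \bar R}.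

(* mu is the product of the mu_ i: as these are finite, the values on
   measurable boxes determine mu. *)
Definition is_product_measure
    (mu : {measure set (d.-tuple (measurableTypeR R)) -> \bar R}) : Prop :=
  forall A : 'I_d -> set (measurableTypeR R), (forall i, measurable (A i)) ->
    mu [set x | forall i, A i (tnth x i)] = (\prod_(i < d) mu_ i (A i))%E.

(* With r 0 = r d = 1 the matrix product is 1 x 1, with entry u x.
   Pitfall: invertibility of the cov_mx (Psi i) (Psi i) does not make r minimal;
   for d = 2 every nonzero u of rank at most r 1 belongs to ftt, if the factor
   spaces are large enough, and ftt is singular at the u of smaller rank.
   Being a manifold is thus a separate property, smooth_submanifold_at. *)
Definition ftt (mu : {measure set (d.-tuple (measurableTypeR R)) -> \bar R})
    (r : nat -> nat) : set (L2 mu) :=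
  [set u | exists Psi : forall i : 'I_d, 'M[L2 (mu_ i)]_(r i, r i.+1),
    (forall i, tt_core (Psi i)) /\
    {ae mu, forall x,
      mxchain (fun i => \matrix_(j, k) (Psi i j k : _ -> R) (tnth x i))
        = const_mx (u x)}].

End functional_tensor_train.

Section submanifold.
Context (R : realType).

(* f is C^k on U, the derivatives being taken along the tangent maps
   (x, h) |-> 'd f x h; requiring this for all k is Frechet smoothness. *)
Fixpoint Ck (k : nat) (V W : normedModType R) (U : set V) (f : V -> W) : Prop :=
  match k with
  | 0 => forall x, U x -> {for x, continuous f}
  | k'.+1 => (forall x, U x -> differentiable f x) /\
      @Ck k' (V * V)%type W (U `*` setT) (fun p => 'd f (p.1) (p.2))
  end.

Definition smooth (V W : normedModType R) (U : set V) (f : V -> W) : Prop :=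
  open U /\ forall k, Ck k U f.

Definition linear_subspace (V : normedModType R) (E : set V) : Prop :=
  E 0 /\ forall (a : R) (x y : V), E x -> E y -> E (a *: x + y).

(* M is, around u, a smooth submanifold of V: some smooth diffeomorphism phi
   (with inverse psi) from a neighborhood U of u onto an open set U' maps
   M `&` U onto the trace on U' of a closed linear subspace E.  In a Hilbert
   space V every such E is complemented and is itself a Hilbert space. *)
Definition smooth_submanifold_at (V : normedModType R) (M : set V) (u : V) :
    Prop :=
  exists (U U' : set V) (phi psi : V -> V) (E : set V),
    [/\ U u, smooth U phi, smooth U' psi,
        (forall x, U x -> U' (phi x) /\ psi (phi x) = x) /\
        (forall y, U' y -> U (psi y) /\ phi (psi y) = y) &
        [/\ linear_subspace E, closed E & phi @` (M `&` U) = E `&` U'] ].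

Definition tangent_space (V : normedModType R) (M : set V) (u : V) : set V :=
  [set v | exists (delta : R) (gamma : R -> V), 0 < delta /\
    [/\ forall s, - delta < s < delta -> M (gamma s),
        forall s, - delta < s < delta -> derivable gamma s 1,
        forall s, - delta < s < delta -> {for s, continuous (derive1 gamma)},
        gamma 0 = u & derive1 gamma 0 = v] ].

End submanifold.

(* Main.v *)
(* In the chart phi straightening the manifold M to a closed subspace E, the
   tangent space at u is the preimage of E under the derivative of phi at u: a
   curve in M has difference quotients that phi sends into E, and conversely a
   tangent vector v is the velocity of psi (phi u + s 'd phi u v).  So the tangent
   space is a closed subspace of L^2, which is complete and satisfies the
   parallelogram law, and the minimizer is the projection of N u onto it. *)

From HB Require Import structures.
Require Import Defs.
From mathcomp Require Import all_boot all_order all_algebra.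
From mathcomp Require Import all_classical all_reals all_analysis.
From mathcomp Require Import measurable_realfun.
From mathcomp Require Import ring lra.

Import Order.TTheory GRing.Theory Num.Theory.
Import numFieldNormedType.Exports.

Local Open Scope classical_set_scope.
Local Open Scope ring_scope.

(** * Completeness of [L2 mu] *)

Section L2_complete.
Context {disp : measure_display} {T : measurableType disp} {R : realType}.
Context {mu : {measure set T -> \bar R}}.
Implicit Type f g : L2 mu.

Lemma measurable_L2 f : measurable_fun setT (f : T -> R).
Proof. exact: measurable_funPT. Qed.

Lemma measurable_sqr_EFin (h : T -> R) :
  measurable_fun setT h -> measurable_fun setT (fun x => (h x ^+ 2)%:E).
Proof. by move=> mh; apply/measurable_EFinP; exact: measurable_funX. Qed.

Lemma L2_sqr_normE f : (`|f| ^+ 2)%:E = (\int[mu]_x (f x ^+ 2)%:E)%E.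
Proof.
have := powR_Lnorm mu (EFin \o f) (r := 2%R).
rewrite pnatr_eq0 => /(_ isT); rewrite -finite_norm_fine poweR_EFin.
rewrite powR_mulrn ?fine_ge0 ?Lnorm_ge0// => ->.
apply: eq_integral => x _ /=.
by rewrite powR_mulrn// real_normK ?num_real.
Qed.

(** Elements of [L2 mu] are classes, so the values of a sum or a difference are known only almost
    everywhere; norms are therefore computed from any measurable representative. The integral stays
    in [\bar R], where nonnegative integrands need no integrability. *)
Lemma L2_sqr_norm_ae f (h : T -> R) : measurable_fun setT h ->
  (f : T -> R) = h %[ae mu] ->
  (`|f| ^+ 2)%:E = (\int[mu]_x (h x ^+ 2)%:E)%E.
Proof.
move=> mh fh; rewrite L2_sqr_normE; apply: ge0_ae_eq_integral => //.
- by apply: measurable_sqr_EFin; exact: measurable_L2.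
- exact: measurable_sqr_EFin.
- by move=> x _; rewrite lee_fin sqr_ge0.
- by move=> x _; rewrite lee_fin sqr_ge0.
- by apply: filterS fh => x /(_ I) -> _.
Qed.

Lemma L2_subE f g : ((f - g : L2 mu) : T -> R) = (fun x => f x - g x) %[ae mu].
Proof.
apply: filterS2 (L2_addE (f - g) g) (aeW mu (fun x => erefl (f x))).
by move=> x /(_ I); rewrite subrK => -> _ _ /=; rewrite addrK.
Qed.

Lemma ex_L2 (h : T -> R) : measurable_fun setT h ->
  (\int[mu]_x (h x ^+ 2)%:E < +oo)%E ->
  exists f, (f : T -> R) = h %[ae mu].
Proof.
move=> mh hoo.
have hL : h \in Lfun mu 2%:E.
  rewrite inE; apply/andP; split; first by rewrite inE.
  rewrite inE/= /finite_norm unlock; apply: poweR_lty.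
  rewrite (eq_integral (fun x => (h x ^+ 2)%:E))// => x _ /=.
  by rewrite powR_mulrn// real_normK ?num_real.
by exists (\pi_(L2 mu) (Lfun_Sub (lee1n 2) hL))%qT; exact: L2_piE.
Qed.

(** Fatou's lemma for the squares: their lower limit is [h x ^+ 2] almost everywhere, and the lower
    limit of their integrals is at most [C]. *)
Lemma L2_fatou (f : nat -> L2 mu) (h : T -> R) (C : R) :
  measurable_fun setT h ->
  {ae mu, forall x, f n x @[n --> \oo] --> h x} ->
  (\forall n \near \oo, `|f n| ^+ 2 <= C) ->
  (\int[mu]_x (h x ^+ 2)%:E <= C%:E)%E.
Proof.
move=> mh fh fC.
have mf n : measurable_fun setT (fun x => (f n x ^+ 2)%:E).
  by apply: measurable_sqr_EFin; exact: measurable_L2.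
have mlim : measurable_fun setT (fun x => limn_einf (fun n => (f n x ^+ 2)%:E)).
  apply: measurableT_comp => //.
  apply: measurable_fun_limn_esup => n.
  by apply: measurableT_comp.
rewrite (ge0_ae_eq_integral _ (measurable_sqr_EFin _ mh) mlim)//.
- apply: (le_trans (fatou mu measurableT mf _)) => //.
    by move=> n x _; rewrite lee_fin sqr_ge0.
  rewrite limn_einf_lim; apply: lime_le; first exact: is_cvg_einfs.
  apply: filterS fC => n fnC.
  (* The infimum over the tail starting at [n] is at most its first term. *)
  apply: (@le_trans _ _ (\int[mu]_x (f n x ^+ 2)%:E)%E).
    by apply: ereal_inf_lbound; exists n => /=.
  by rewrite -L2_sqr_normE lee_fin.
- by move=> x _; rewrite lee_fin sqr_ge0.
- move=> x _; rewrite limn_einf_lim; apply: lime_ge; first exact: is_cvg_einfs.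
  apply: nearW => n; apply: le_ereal_inf_tmp => _ [m _ <-].
  by rewrite lee_fin sqr_ge0.
- apply: filterS fh => x fh _.
  apply/esym; apply: (cvg_limn_einf_sup _).1.
  by apply: cvg_EFin; [exact: nearW|rewrite expr2; exact: (cvgM fh fh)].
Qed.

(** The squared increments, weighted by [4 ^+ n], still have a summable integral, so their sum [S]
    is finite almost everywhere. Where [S x] is finite, the n-th increment at [x] is at most
    [sqrt (S x) / 2 ^ n], and the telescoping series converges absolutely. Using squares avoids any
    passage to L^1, so [mu] may be infinite. *)
Lemma L2_ae_cvg (f : nat -> L2 mu) :
  (forall n, `|f n.+1 - f n| <= 4^-1 ^+ n.+1) ->
  exists h : T -> R, measurable_fun setT h /\
    {ae mu, forall x, f n x @[n --> \oo] --> h x}.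
Proof.
move=> fastf.
pose g n x : \bar R := (4 ^+ n * (f n.+1 x - f n x) ^+ 2)%:E.
have g0 n x : (0 <= g n x)%E by rewrite lee_fin mulr_ge0 ?sqr_ge0// exprn_ge0.
have mg n : measurable_fun setT (g n).
  apply/measurable_EFinP; apply: measurable_funM; first exact: measurable_cst.
  by apply: measurable_funX; apply: measurable_funB; exact: measurable_L2.
pose S x := (\sum_(0 <= n <oo) g n x)%E.
have S0 x : (0 <= S x)%E by apply: nneseries_ge0 => n _ _; exact: g0.
have mS : measurable_fun setT S.
  by apply: (ge0_emeasurable_sum (P := xpredT)) => [k x _ _|k _]; [exact: g0|exact: mg].
(* The integral is at most [4^n / 16^(n+1)]; it is weakened to the shape that [epsilon_trick0] sums
   to at most 1. *)
have intg n : (\int[mu]_x g n x <= (1 / (2 ^ n.+1)%:R)%:E)%E.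
  under eq_integral do rewrite /g EFinM.
  rewrite ge0_integralZl//; last 2 first.
  - by apply: measurable_sqr_EFin; apply: measurable_funB; exact: measurable_L2.
  - by move=> x _; rewrite lee_fin sqr_ge0.
  rewrite -(L2_sqr_norm_ae (f n.+1 - f n)); last 2 first.
  - by apply: measurable_funB; exact: measurable_L2.
  - exact: L2_subE.
  rewrite -EFinM lee_fin natrX div1r -exprVn.
  apply: (@le_trans _ _ (4 ^+ n * (4^-1 ^+ n.+1) ^+ 2)).
    by rewrite ler_wpM2l ?exprn_ge0// lerXn2r ?nnegrE ?exprn_ge0 ?invr_ge0.
  rewrite expr2 mulrA -[leRHS]mul1r; apply: ler_pM.
  - by rewrite mulr_ge0 ?exprn_ge0// invr_ge0.
  - by rewrite exprn_ge0// invr_ge0.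
  - by rewrite exprVn ler_pdivrMr ?exprn_gt0// mul1r ler_weXn2l// ler1n.
  - by rewrite lerXn2r ?nnegrE ?invr_ge0// lef_pV2 ?posrE// ler_nat.
have S_fin : {ae mu, forall x, S x \is a fin_num}.
  have : mu.-integrable setT S.
    apply/integrableP; split => //.
    apply: (@le_lt_trans _ _ (\int[mu]_x S x)%E).
      apply: ge0_le_integral => //.
      - exact: measurableT_comp.
      - by move=> x _; rewrite gee0_abs.
    rewrite integral_nneseries//.
    apply: (@le_lt_trans _ _ (1%:E)); last exact: ltry.
    apply: le_trans (epsilon_trick0 xpredT ler01).
    by apply: lee_nneseries => [n _ _|n _]; [exact: integral_ge0|exact: intg].
  move=> /(integrable_ae measurableT); apply: filterS => x; exact.
pose A := [set x | S x \is a fin_num].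
have mA : measurable A.
  by rewrite -[A]setTI; exact: emeasurable_fin_num.
have cvgA x : A x -> cvgn (fun n => f n x).
  move=> Ax.
  have K0 : 0 <= fine (S x) by exact: fine_ge0.
  pose K := Num.sqrt (fine (S x)).
  have gK n : `|f n.+1 x - f n x| <= K * 2^-1 ^+ n.
    rewrite -ler_sqr ?nnegrE ?mulr_ge0 ?sqrtr_ge0 ?exprn_ge0 ?invr_ge0//.
    rewrite real_normK ?num_real// exprMn sqr_sqrtr// -exprM mulnC exprM.
    have -> : 2^-1 ^+ 2 = 4^-1 :> R by rewrite exprVn -natrX.
    rewrite exprVn ler_pdivlMr ?exprn_gt0// mulrC -lee_fin fineK//.
    (* A single term is at most the partial sum ending with it, hence at most [S x]. *)
    rewrite (le_trans _ (nneseries_lim_ge n.+1 _))//.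
    by rewrite big_nat_recr//= leeDr// sume_ge0.
  have -> : (fun n => f n x) =
      (fun n => f 0%N x + series (telescope (fun n => f n x)) n).
    by apply/funext => n; exact: eq_sum_telescope.
  apply: is_cvgD; first exact: is_cvg_cst.
  apply: normed_cvg.
  apply: (series_le_cvg (v_ := geometric K 2^-1)) => //.
  - by move=> n; exact: normr_ge0.
  - by move=> n; rewrite /geometric/= mulr_ge0 ?sqrtr_ge0// exprn_ge0// invr_ge0.
  - by apply: is_cvg_geometric_series; rewrite ger0_norm// invf_lt1// ltr1n.
(* The indicator of [A] forces convergence at every point, which gives measurability of the limit;
   it alters the sequence only on a null set. *)
exists (fun x => limn (fun n => f n x * \1_A x)); split; last first.
  apply: filterS S_fin => x Ax; rewrite indicE mem_set//.
  have -> : (fun n => f n x * true%:R) = (fun n => f n x).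
    by apply/funext => n; rewrite mulr1.
  exact: cvgA.
apply: (measurable_fun_cvg (h := fun n x => f n x * \1_A x)).
  by move=> n; apply: measurable_funM; [exact: measurable_L2|exact: measurable_indic].
move=> x _; suff : cvgn (fun n => f n x * \1_A x) by [].
rewrite indicE; have [/set_mem Ax|_] := boolP (x \in A).
  by apply: is_cvgM; [exact: cvgA|exact: is_cvg_cst].
have -> : (fun n => f n x * false%:R) = cst 0 by apply/funext => n; rewrite mulr0.
exact: is_cvg_cst.
Qed.


(** Let [h] be the almost everywhere limit. Fatou applied to [f m - f n] as [m] grows bounds the
    norm of [h - f n] by [4^-1 ^+ n.+1], so convergence also holds in norm. *)
Lemma L2_fast_cvg (f : nat -> L2 mu) :
  (forall m n, (n <= m)%N -> `|f m - f n| <= 4^-1 ^+ n.+1) -> cvgn f.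
Proof.
move=> fastf.
have [h [mh fh]] := L2_ae_cvg f (fun n => fastf _ _ (leqnSn n)).
have hf n : (\int[mu]_x ((h x - f n x) ^+ 2)%:E <= ((4^-1 ^+ n.+1) ^+ 2)%:E)%E.
  apply: (@L2_fatou (fun m => f m - f n)).
  - by apply: measurable_funB => //; exact: measurable_L2.
  - have mn : {ae mu, forall x, forall m,
        (f m - f n : L2 mu) x = f m x - f n x}.
      by apply/ae_foralln => m; apply: filterS (L2_subE (f m) (f n)) => x; exact.
    apply: filterS2 fh mn => x fh mn; under eq_cvg do rewrite mn.
    by apply: cvgB => //; exact: cvg_cst.
  - exists n => // m /= nm.
    by rewrite lerXn2r ?nnegrE ?exprn_ge0 ?invr_ge0// fastf.
have mhf n : measurable_fun setT (fun x => h x - f n x).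
  by apply: measurable_funB => //; exact: measurable_L2.
(* The bound at [n = 0] makes [h - f 0] square-integrable; adding [f 0] back gives the class of
   [h]. *)
have [g gh] := ex_L2 (fun x => h x - f 0%N x) (mhf 0%N) (le_lt_trans (hf _) (ltry _)).
have gf n : `|(g + f 0%N) - f n| <= 4^-1 ^+ n.+1.
  rewrite -ler_sqr ?nnegrE ?exprn_ge0 ?invr_ge0// -lee_fin.
  rewrite (L2_sqr_norm_ae _ _ (mhf n))//.
  have e1 := L2_subE (g + f 0%N) (f n); have e2 := L2_addE g (f 0%N).
  apply: filterS3 gh e1 e2 => x /(_ I) gx /(_ I) e1 /(_ I) e2 _.
  by rewrite e1 e2 /= gx subrK.
apply/cvg_ex; exists (g + f 0%N); apply/cvgrPdist_le => e e0.
have : geometric 4^-1 4^-1 @ \oo --> (0 : R).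
  by apply: cvg_geometric; rewrite ger0_norm ?invr_ge0// invf_lt1// ltr1n.
move=> /cvgrPdist_le/(_ e e0); apply: filterS => n /=.
rewrite sub0r normrN ger0_norm ?mulr_ge0 ?exprn_ge0 ?invr_ge0// -exprS.
exact: le_trans.
Qed.

(** The centers of ever smaller balls belonging to [F] form a fast Cauchy sequence, and its limit is
    the limit of [F]. *)
Lemma L2_cauchy_cvg (F : set_system (L2 mu)) :
  ProperFilter F -> cauchy F -> cvg F.
Proof.
move=> FF /cauchyP Fc.
(* Half of the fast rate: two of these balls meet because [F] is proper, and their two radii add up
   to at most the larger rate. *)
have e0 n : 0 < 4^-1 ^+ n.+1 / 2 :> R by rewrite divr_gt0// exprn_gt0// invr_gt0.
have [f fF] := choice (fun n => Fc _ (e0 n)).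
have fastf m n : (n <= m)%N -> `|f m - f n| <= 4^-1 ^+ n.+1.
  move=> nm; have [z [zm zn]] := filter_ex (filterI (fF m) (fF n)).
  rewrite (le_trans (ler_distD z _ _))// [leRHS]splitr.
  move: zm zn; rewrite -!ball_normE/= => /ltW zm /ltW zn.
  rewrite lerD//; last by rewrite distrC.
  rewrite (le_trans zm)// ler_wpM2r ?invr_ge0//.
  by rewrite ler_wiXn2l ?invr_ge0// ?invf_le1 ?ler1n.
have /cvg_ex[g fg] := L2_fast_cvg f fastf.
apply/cvg_ex; exists g; apply/cvgrPdist_le => e egt0.
have e2 : 0 < e / 2 by rewrite divr_gt0.
have : geometric 4^-1 4^-1 @ \oo --> (0 : R).
  by apply: cvg_geometric; rewrite ger0_norm ?invr_ge0// invf_lt1// ltr1n.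
move=> /cvgrPdist_le/(_ _ e2) small.
move/cvgrPdist_le : fg => /(_ _ e2) fg.
have [n [gn]] := filter_ex (filterI fg small).
rewrite /= sub0r normrN ger0_norm ?mulr_ge0 ?exprn_ge0 ?invr_ge0// -exprS => sn.
apply: filterS (fF n) => z; rewrite -ball_normE/= => /ltW zn.
rewrite (le_trans (ler_distD (f n) _ _))// [leRHS]splitr lerD//.
by rewrite (le_trans zn)// (le_trans _ sn)// ler_piMr ?exprn_ge0 ?invr_ge0// invf_le1 ?ler1n.
Qed.

End L2_complete.

HB.instance Definition _ (disp : measure_display) (T : measurableType disp)
    (R : realType) (mu : {measure set T -> \bar R}) :=
  Uniform_isComplete.Build (L2 mu) (@L2_cauchy_cvg disp T R mu).

(** * Best approximation in a closed linear subspace *)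

Section best_approximation.
Context {R : realType} {V : completeNormedModType R}.
(** This law stands in for an inner product, as [V] carries only a norm. *)
Hypothesis parallelogram : forall x y : V,
  `|x + y| ^+ 2 + `|x - y| ^+ 2 = 2 * `|x| ^+ 2 + 2 * `|y| ^+ 2.
Variables (E : set V) (a : V).
Hypotheses (linE : linear_subspace E) (closedE : closed E).

Let dist (x : V) := `|x - a| ^+ 2.
Let m := inf (dist @` E).

Let dist_lb : lbound (dist @` E) 0.
Proof. by move=> _ [x _ <-]; exact: sqr_ge0. Qed.

Let inf_dist x : E x -> m <= dist x.
Proof. by move=> Ex; apply: ge_inf; [exists 0|exists x]. Qed.

(* The midpoint of x and y lies in E, so its distance to a is at least m. *)
Let midpoint x y : E x -> E y ->
  `|x - y| ^+ 2 <= 2 * (dist x - m) + 2 * (dist y - m).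
Proof.
move=> Ex Ey; have := parallelogram (x - a) (y - a).
have Exy : E (2^-1 *: (x + y)).
  have := linE.2 2^-1 (x + y) 0; rewrite addr0; apply; last exact: linE.1.
  by have := linE.2 1 x y Ex Ey; rewrite scale1r.
have -> : x - a + (y - a) = 2 *: (2^-1 *: (x + y) - a).
  by rewrite scalerBr scalerA divff// scale1r scaler_nat mulr2n opprD addrACA.
have -> : x - a - (y - a) = x - y.
  by rewrite opprB addrA subrK.
rewrite normrZ exprMn ger0_norm// => eq.
have := inf_dist _ Exy; rewrite /dist in eq *; nra.
Qed.

(** By [midpoint], a minimizing sequence is Cauchy; its limit stays in the closed set [E] and
    attains the infimum [m]. The same inequality makes two minimizers coincide. *)
Lemma ex_unique_best_approximation :
  exists! v, E v /\ forall w, E w -> `|v - a| ^+ 2 <= `|w - a| ^+ 2.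
Proof.
have hasinf : has_inf (dist @` E).
  by split; [exists (dist 0), 0 => //; exact: linE.1|exists 0].
have seq n : exists x, E x /\ dist x < m + n.+1%:R^-1.
  have n0 : 0 < n.+1%:R^-1 :> R by rewrite invr_gt0.
  by have [_ [x Ex <-] xm] := inf_adherent n0 hasinf; exists x.
have [f fP] := choice seq.
have fle n k : (k <= n)%N -> dist (f n) - m <= k.+1%:R^-1.
  move=> kn; rewrite lerBlDl (le_trans (ltW (fP n).2))// lerD2l.
  by rewrite lef_pV2 ?posrE// ler_nat ltnS.
have cf : cvgn f.
  apply/cauchy_cvgP/cauchyP => e e0.
  have : n.+1%:R^-1 @[n --> \oo] --> (0 : R) by exact: cvg_harmonic.
  (* Each of the two gaps in [midpoint] is below [e ^+ 2 / 8] and is counted twice, for a total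
     below [e ^+ 2 / 2]. *)
  have e2 : 0 < e ^+ 2 / 8 by rewrite divr_gt0// exprn_gt0.
  move=> /cvgrPdist_lt/(_ _ e2)[k _ /(_ k (leqnn k))/=].
  rewrite sub0r normrN ger0_norm ?invr_ge0// => ke.
  exists (f k); exists k => // n /= kn.
  rewrite -ball_normE/= -ltr_sqr ?nnegrE ?(ltW e0)//.
  apply: (le_lt_trans (midpoint _ _ (fP k).1 (fP n).1)).
  have h1 := fle _ _ (leqnn k); have h2 := fle _ _ kn.
  move: h1 h2 ke e2.
  by move: (dist (f k)) (dist (f n)) m (_^-1) (e ^+ 2) => *; lra.
have fv : f @ \oo --> lim (f @ \oo) := cf.
set v := lim (f @ \oo) in fv.
have Ev : E v by apply: (closed_cvg _ closedE _ _ fv); apply: nearW => n; exact: (fP n).1.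
have vm : dist v <= m.
  have d1 : dist (f n) @[n --> \oo] --> dist v.
    rewrite /dist expr2; apply: cvgM; apply: cvg_norm; apply: cvgB => //;
      exact: cvg_cst.
  have d2 : m + n.+1%:R^-1 @[n --> \oo] --> m.
    by rewrite -[X in _ --> X]addr0; apply: cvgD; [exact: cvg_cst|exact: cvg_harmonic].
  by apply: (ler_cvg_to d1 d2); apply: nearW => n; exact/ltW/(fP n).2.
exists v; split; first by split => // w Ew; exact: (le_trans vm (inf_dist _ Ew)).
move=> w [Ew wmin]; apply/eqP; rewrite -subr_eq0 -normr_eq0 -sqrf_eq0.
rewrite eq_le sqr_ge0 andbT (le_trans (midpoint _ _ Ev Ew))//.
(* Since [dist w <= dist v <= m], both gaps are nonpositive. *)
by have := wmin _ Ev; rewrite -/(dist w) -/(dist v); lra.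
Qed.

End best_approximation.

(** The pointwise identity between squares is integrated. In [\bar R] all integrands are
    nonnegative, so integrability of the cross term [f x * g x] never arises. *)
Lemma L2_parallelogram {disp : measure_display} {T : measurableType disp}
    {R : realType} {mu : {measure set T -> \bar R}} (f g : L2 mu) :
  `|f + g| ^+ 2 + `|f - g| ^+ 2 = 2 * `|f| ^+ 2 + 2 * `|g| ^+ 2.
Proof.
have ge0 (h : T -> R) x : (0 <= (h x ^+ 2)%:E)%E by rewrite lee_fin sqr_ge0.
have mf := measurable_L2 f; have mg := measurable_L2 g.
have mD : measurable_fun setT (fun x => f x + g x) by exact: measurable_funD.
have mB : measurable_fun setT (fun x => f x - g x) by exact: measurable_funB.
suff : ((`|f + g| ^+ 2)%:E + (`|f - g| ^+ 2)%:E =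
        2%:E * (`|f| ^+ 2)%:E + 2%:E * (`|g| ^+ 2)%:E)%E.
  by rewrite -!EFinM -!EFinD => -[].
rewrite (L2_sqr_norm_ae _ _ mD (L2_addE f g)) (L2_sqr_norm_ae _ _ mB (L2_subE f g)).
rewrite !L2_sqr_normE -!ge0_integralZl//; try exact: measurable_sqr_EFin.
rewrite -!ge0_integralD//; try by
  [exact: measurable_sqr_EFin
  |apply: measurable_funeM; exact: measurable_sqr_EFin
  |move=> x _; rewrite lee_fin sqr_ge0
  |move=> x _; apply: mule_ge0].
by apply: eq_integral => x _; rewrite -!EFinM -!EFinD; congr EFin; ring.
Qed.

(** * The tangent space of a submanifold at a point *)

Section tangent_space_submanifold.
Context {R : realType} {V : normedModType R}.
Implicit Types (M E U : set V) (u v : V).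

Lemma linear_subspaceZ {E} (a : R) {x} : linear_subspace E -> E x -> E (a *: x).
Proof. by move=> [E0 El] Ex; have := El a x 0 Ex E0; rewrite addr0. Qed.

Lemma linear_subspaceB {E x y} : linear_subspace E -> E x -> E y -> E (x - y).
Proof.
by move=> [E0 El] Ex Ey; have := El (-1) y x Ey Ex; rewrite scaleN1r addrC.
Qed.

Lemma derive1_comp_diff (W : normedModType R) (f : V -> W) (g : R -> V) s :
  derivable g s 1 -> differentiable f (g s) ->
  derivable (f \o g) s 1 /\ derive1 (f \o g) s = 'd f (g s) (derive1 g s).
Proof.
move=> /derivable1_diffP dg df.
have dfg : differentiable (f \o g) s by exact: differentiable_comp.
split; first exact/derivable1_diffP.
by rewrite !derive1E !deriveE// diff_comp.
Qed.

Lemma tangent_space_submanifold M u U U' (phi psi : V -> V) E :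
  M u -> U u -> smooth U phi -> smooth U' psi ->
  (forall x, U x -> U' (phi x) /\ psi (phi x) = x) ->
  (forall y, U' y -> U (psi y) /\ phi (psi y) = y) ->
  linear_subspace E -> closed E -> phi @` (M `&` U) = E `&` U' ->
  tangent_space M u = [set v | E ('d phi u v)].
Proof.
move=> Mu Uu [oU Cphi] [oU' Cpsi] UU' U'U lE cE ME.
(* [cdpsi] is the joint continuity of ['d psi y h] in [(y, h)]; it will make the velocity of the
   constructed curve continuous. *)
have [dphi _] := Cphi 1%N; have [dpsi cdpsi] := Cpsi 1%N.
apply/seteqP; split => v.
  move=> [delta [gamma [d0 [gM dg _ g0 <-]]]] /=.
  have d00 : - delta < 0 < delta by rewrite oppr_lt0 d0.
  have dg0 := dg 0 d00.
  have dpg0 : differentiable phi (gamma 0) by rewrite g0; exact: dphi.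
  have [dpg pgE] := derive1_comp_diff V phi gamma 0 dg0 dpg0.
  suff : E ('d phi (gamma 0) (derive1 gamma 0)) by rewrite g0.
  rewrite -pgE derive1E; apply: (closed_cvg E cE _ _ dpg).
  have cg : {for 0, continuous gamma}.
    by apply: differentiable_continuous; exact/derivable1_diffP.
  have Ug : \forall h \near 0, U (gamma h).
    by apply: cg; rewrite g0; exact: open_nbhs_nbhs.
  have Eg h : - delta < h < delta -> U (gamma h) -> E (phi (gamma h)).
    move=> hd Uh; suff [] : (E `&` U') (phi (gamma h)) by [].
    by rewrite -ME; exists (gamma h) => //; split => //; exact: gM.
  (* All [h] near 0 are treated, not only the nonzero ones: [E] is stable under every scalar,
     including the default value of [0^-1]. *)
  apply: cvg_within; near=> h.
  apply: linear_subspaceZ => //; apply: linear_subspaceB => //=.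
    rewrite [_%:A]mulr1 addr0; apply: Eg; last by near: h.
    by near: h; exact: near_in_itvoo.
  by apply: Eg => //; rewrite g0.
move=> /= Ev.
(* Both [phi u] and [e] lie in [E], so the whole line does, and [psi] sends its part inside [U'] to
   [M]. *)
pose e := 'd phi u v; pose line s := phi u + s *: e.
have dline s : derivable line s 1 /\ derive1 line s = e.
  have dq : h^-1 *: ((line \o shift s) (h *: 1) - line s) @[h --> 0^'] --> e.
    apply: cvg_near_cst; near=> h.
    rewrite /line /= [_%:A]mulr1 opprD addrACA subrr add0r -scalerBl addrK.
    by rewrite scalerA mulVf ?scale1r//; near: h; exact: nbhs_dnbhs_neq.
  split; first by apply/cvg_ex; exists e.
  by rewrite derive1E; exact: cvg_lim dq.
have line0 : line 0 = phi u by rewrite /line scale0r addr0.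
have cline s : {for s, continuous line}.
  by apply: differentiable_continuous; apply/derivable1_diffP; exact: (dline s).1.
have [U'u psiu] := UU' _ Uu.
have Ephiu : E (phi u).
  by suff [] : (E `&` U') (phi u) by []; rewrite -ME; exists u.
have U'near s : U' (line s) -> \forall t \near s, U' (line t).
  by move=> U's; apply: cline; exact: open_nbhs_nbhs.
have [delta d0 U'line] : exists2 delta, 0 < delta &
    forall s, - delta < s < delta -> U' (line s).
  have /U'near /nbhs_ballP[delta /= d0 dU] : U' (line 0) by rewrite line0.
  exists delta => // s sd; apply: dU.
  by rewrite -ball_normE /= sub0r normrN ltr_norml.
have dg s : U' (line s) -> derivable (psi \o line) s 1 /\
     derive1 (psi \o line) s = 'd psi (line s) e.
  move=> U's; have [dl <-] := dline s.
  by apply: derive1_comp_diff => //; exact: dpsi.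
exists delta, (psi \o line); split => //; split.
- move=> s /U'line U's.
  have : (E `&` U') (line s).
    by split => //; rewrite /line addrC; exact: lE.2.
  by rewrite -ME => -[x [Mx Ux] /= <-]; rewrite (UU' x Ux).2.
- by move=> s /U'line /dg[].
- move=> s /U'line U's.
  have cd : 'd psi (line t) e @[t --> s] --> 'd psi (line s) e.
    have pc : (line t, e) @[t --> s] --> (line s, e).
      by apply: cvg_pair; [exact: cline|exact: cvg_cst].
    exact: (cvg_comp _ _ pc (cdpsi (line s, e) _)).
  suff : derive1 (psi \o line) t @[t --> s] --> derive1 (psi \o line) s by [].
  rewrite (dg s U's).2; apply: cvg_trans cd.
  (* The formula for the derivative holds where [line t] lies in the open set [U'], that is, for all
     [t] near [s]. *)
  apply: near_eq_cvg; apply: filterS (U'near s U's) => t U't.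
  by rewrite (dg t U't).2.
- by rewrite /= line0.
(* By the chain rule the velocity at 0 is the derivative of [psi \o phi] at [u] along [v]; this map
   is the identity near [u]. *)
- have := (dg 0); rewrite line0 => /(_ U'u)[_ ->].
  rewrite -[LHS]/(('d psi (phi u) \o 'd phi u) v) -diff_comp; first last.
  + exact: dpsi.
  + exact: dphi.
  rewrite -deriveE; last by apply: differentiable_comp; [exact: dphi|exact: dpsi].
  rewrite (@near_eq_derive _ _ _ _ id).
    by rewrite derive_id.
  by apply: filterS (open_nbhs_nbhs (conj oU Uu)) => x /UU'[].
Unshelve. all: by end_near. Qed.

(** Both properties pull back from [E] along ['d phi u], which is linear and continuous. *)
Lemma tangent_space_closed_subspace M u :
  M u -> smooth_submanifold_at M u ->
  linear_subspace (tangent_space M u) /\ closed (tangent_space M u).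
Proof.
move=> Mu [U [U' [phi [psi [E [Uu sU sU' [UU' U'U] [lE cE ME]]]]]]].
have -> := tangent_space_submanifold M u U U' phi psi E Mu Uu sU sU' UU' U'U lE cE ME.
have dphi : differentiable phi u by exact: (sU.2 1%N).1.
split; first split.
- by rewrite /= linear0; exact: lE.1.
- by move=> a x y Ex Ey; rewrite /= linearP; exact: lE.2.
- apply: (@closed_comp _ _ ('d phi u)) cE => x _.
  exact: (diff_continuous dphi).
Qed.

End tangent_space_submanifold.

(** * Projection of [N u] onto the tangent space of the tensor train manifold *)

Theorem proposition4p1 (R : realType) (d : nat) (hd : (0 < d)%N)
    (a b : 'I_d -> R) (hab : forall i, a i <= b i)
    (mu_ : 'I_d -> {finite_measure set (measurableTypeR R) -> \bar R})
    (hmu_ : forall i, mu_ i (~` `[a i, b i]) = 0%E)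
    (mu : {measure set (d.-tuple (measurableTypeR R)) -> \bar R})
    (hmu : is_product_measure mu_ mu)
    (r : nat -> nat) (hr : forall i, (i <= d)%N -> (0 < r i)%N)
    (hr0 : r 0%N = 1%N) (hrd : r d = 1%N)
    (u : L2 mu) (hu : ftt mu_ r u)
    (hmanifold : smooth_submanifold_at (ftt mu_ r) u)
    (N : L2 mu -> L2 mu) (hN : ~ ftt mu_ r (N u)) :
  exists! v : L2 mu,
    tangent_space (ftt mu_ r) u v /\
    forall w : L2 mu, tangent_space (ftt mu_ r) u w ->
      `|v - N u| ^+ 2 <= `|w - N u| ^+ 2.
Proof.
have [linT closedT] := tangent_space_closed_subspace _ _ hu hmanifold.
exact: (ex_unique_best_approximation L2_parallelogram).
Qed.
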